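(* Let $p$ be an odd prime and let $G$ be a finite $p$-group. If the nilpotency class of $G$ is $c$, then $\exp(G\wedge G)$ divides $p^{n-1}\exp(G)$, where $n=\lceil \log_p(c+1)\rceil$. In particular, $\exp(H_2(G,\mathbb{Z}))$ divides $p^{n-1}\exp(G)$.
   Context: $\exp(H)$ denotes the exponent of a finite group $H$, i.e. the least positive integer $e$ with $h^e=1$ for all $h\in H$. $G\wedge G$ is the nonabelian exterior square of $G$: the group generated by symbols $g\wedge h$ ($g,h\in G$) subject to the relations $gg'\wedge h=({}^{g}g'\wedge {}^{g}h)(g\wedge h)$, $g\wedge hh'=(g\wedge h)({}^{h}g\wedge {}^{h}h')$ and $g\wedge g=1$ for all $g,g',h,h'\in G$, where ${}^{g}h=ghg^{-1}$. For finite $G$ it is isomorphic to the commutator subgroup $\gamma_2(H)$ of any covering group $H$ of $G$. $H_2(G,\mathbb{Z})$ is the second integral homology group (Schur multiplier) of $G$, which is isomorphic to the kernel of the commutator map $G\wedge G\to G$, $g\wedge h\mapsto ghg^{-1}h^{-1}$. $\lceil\cdot\rceil$ is the ceiling function. *)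

(* Defs.v *)
From HB Require Import structures.
From mathcomp Require Import all_boot all_order all_algebra.
From mathcomp Require Import all_fingroup all_solvable.
From mathcomp Require Import boolp ring.

Set Implicit Arguments.
Unset Strict Implicit.
Unset Printing Implicit Defensive.

Import GRing.Theory.

(* The value is 0 when no positive integer satisfies P; as 0 divides no        *)
(* positive integer, [least_pos P %| m] with m > 0 entails that one does.      *)
Definition least_pos (P : nat -> Prop) : nat :=
  if pselect (exists e, (0 < e) && `[< P e >]) is left exP then ex_minn exP
  else 0.

Lemma least_posP (P : nat -> Prop) : (exists2 e, 0 < e & P e) ->
  [/\ 0 < least_pos P, P (least_pos P) &
      forall e, 0 < e -> P e -> least_pos P <= e].
Proof.
case=> e e0 Pe; rewrite /least_pos; case: pselect => [exP|[]]; last first.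
  by exists e; rewrite e0; apply/asboolP.
case: ex_minnP => m /andP[m0 /asboolP Pm] mle; split=> // k k0 Pk.
by apply: mle; rewrite k0; apply/asboolP.
Qed.

(* [exponent] of the library only concerns subsets of a [finGroupType].        *)
Definition group_exp (H : groupType) : nat :=
  least_pos (fun e => forall h : H, (h ^+ e = 1)%g).

Definition zmod_exp (A : zmodType) : nat :=
  least_pos (fun e => forall a : A, (a *+ e = 0)%R).

(* The nonabelian exterior square G /\ G, as the quotient of the group terms   *)
(* over the symbols g /\ h by the congruence generated by the group axioms     *)
(* and the defining relations. Conjugates ^g x = g x g^-1 are spelled out,     *)
(* since the library's x ^ g stands for g^-1 x g.                              *)
Section ExteriorSquare.

Variable G : groupType.
Local Open Scope group_scope.

Inductive ext_term : Type :=
| TWedge of G & G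
| TOne
| TInv of ext_term
| TMul of ext_term & ext_term.

Inductive ext_cong : ext_term -> ext_term -> Prop :=
| cong_refl a : ext_cong a a
| cong_sym a b : ext_cong a b -> ext_cong b a
| cong_trans a b c : ext_cong a b -> ext_cong b c -> ext_cong a c
| cong_inv a a' : ext_cong a a' -> ext_cong (TInv a) (TInv a')
| cong_mul a a' b b' : ext_cong a a' -> ext_cong b b' ->
    ext_cong (TMul a b) (TMul a' b')
| cong_mulA a b c : ext_cong (TMul a (TMul b c)) (TMul (TMul a b) c)
| cong_mul1 a : ext_cong (TMul TOne a) a
| cong_mulr1 a : ext_cong (TMul a TOne) a
| cong_mulV a : ext_cong (TMul (TInv a) a) TOne
| cong_mulrV a : ext_cong (TMul a (TInv a)) TOne
| cong_wedgeMl g g' h :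
    ext_cong (TWedge (g * g') h)
             (TMul (TWedge (g * g' * g^-1) (g * h * g^-1)) (TWedge g h))
| cong_wedgeMr g h h' :
    ext_cong (TWedge g (h * h'))
             (TMul (TWedge g h) (TWedge (h * g * h^-1) (h * h' * h^-1)))
| cong_wedgegg g : ext_cong (TWedge g g) TOne.

HB.instance Definition _ := gen_eqMixin ext_term.
HB.instance Definition _ := gen_choiceMixin ext_term.

Definition ext_rel : rel ext_term := fun a b => `[< ext_cong a b >].

Lemma ext_rel_equiv : equiv_class_of ext_rel.
Proof.
split=> [a|a b|b a c].
- exact/asboolP/cong_refl.
- by apply/asboolP/asboolP; apply: cong_sym.
- by move=> /asboolP ab /asboolP bc; apply/asboolP; apply: cong_trans ab bc.
Qed.

Canonical ext_equiv := EquivRelPack ext_rel_equiv.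
Canonical ext_encModRel := defaultEncModRel ext_rel.

Definition ext_square := {eq_quot ext_rel}%qT.

HB.instance Definition _ := EqQuotient.on ext_square.
HB.instance Definition _ := Choice.on ext_square.

Definition ext_pi (a : ext_term) : ext_square := (\pi_ext_square a)%qT.

Lemma ext_piP a b : ext_pi a = ext_pi b <-> ext_cong a b.
Proof.
by split=> [/eqmodP/asboolP//|ab]; apply/eqmodP/asboolP.
Qed.

Definition ext_one : ext_square := ext_pi TOne.
Definition ext_inv (x : ext_square) : ext_square :=
  ext_pi (TInv (generic_quotient.repr x)).
Definition ext_mul (x y : ext_square) : ext_square :=
  ext_pi (TMul (generic_quotient.repr x) (generic_quotient.repr y)).

Lemma ext_reprP a : ext_cong (generic_quotient.repr (ext_pi a)) a.
Proof. by apply/ext_piP; rewrite /ext_pi reprK. Qed.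

Lemma ext_piV a : ext_inv (ext_pi a) = ext_pi (TInv a).
Proof. by apply/ext_piP/cong_inv/ext_reprP. Qed.

Lemma ext_piM a b : ext_mul (ext_pi a) (ext_pi b) = ext_pi (TMul a b).
Proof. by apply/ext_piP/cong_mul; apply: ext_reprP. Qed.

Lemma ext_pi_surj x : exists a, x = ext_pi a.
Proof. by exists (generic_quotient.repr x); rewrite /ext_pi reprK. Qed.

Lemma ext_mulA : associative ext_mul.
Proof.
move=> x y z; have [[a ->] [b ->] [c ->]] :=
  And3 (ext_pi_surj x) (ext_pi_surj y) (ext_pi_surj z).
by rewrite !ext_piM; apply/ext_piP/cong_mulA.
Qed.

Lemma ext_mul1 : left_id ext_one ext_mul.
Proof.
by move=> x; have [a ->] := ext_pi_surj x; rewrite ext_piM; apply/ext_piP/cong_mul1.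
Qed.

Lemma ext_mulr1 : right_id ext_one ext_mul.
Proof.
by move=> x; have [a ->] := ext_pi_surj x; rewrite ext_piM; apply/ext_piP/cong_mulr1.
Qed.

Lemma ext_mulV : left_inverse ext_one ext_inv ext_mul.
Proof.
move=> x; have [a ->] := ext_pi_surj x.
by rewrite ext_piV ext_piM; apply/ext_piP/cong_mulV.
Qed.

Lemma ext_mulrV : right_inverse ext_one ext_inv ext_mul.
Proof.
move=> x; have [a ->] := ext_pi_surj x.
by rewrite ext_piV ext_piM; apply/ext_piP/cong_mulrV.
Qed.

HB.instance Definition _ :=
  isGroup.Build ext_square ext_mulA ext_mul1 ext_mulr1 ext_mulV ext_mulrV.

End ExteriorSquare.

(* H_2(G, Z), as the homology in degree 2 of the (inhomogeneous) bar complex   *)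
(* of G with trivial integer coefficients; the chains of degree n are the free *)
(* abelian group Z[G^n], realised as the functions from the finite set G^n to  *)
(* Z.                                                                          *)
Section BarHomology.

Variable G : finGroupType.
Local Open Scope ring_scope.

Definition chain (T : finType) := {ffun T -> int}.

Definition cell (T : finType) (t : T) : chain T := [ffun t' => (t' == t)%:R].

Definition lin_ext (T : finType) (V : zmodType) (f : T -> V) (z : chain T) : V :=
  \sum_t f t *~ z t.

Definition bar_d2 : chain (G * G)%type -> chain G :=
  lin_ext (fun '(g, h) => cell h - cell (g * h)%g + cell g).

Definition bar_d3 : chain (G * G * G)%type -> chain (G * G)%type :=
  lin_ext (fun '(g, h, k) =>
    cell (h, k) - cell ((g * h)%g, k) + cell (g, (h * k)%g) - cell (g, h)).

Lemma lin_extB (T : finType) (V : zmodType) (f : T -> V) :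
  {morph lin_ext f : x y / x - y}.
Proof.
move=> x y; rewrite /lin_ext -sumrB; apply: eq_bigr => t _.
by rewrite !ffunE mulrzBr.
Qed.

HB.instance Definition _ (T : finType) (V : zmodType) (f : T -> V) :=
  GRing.isZmodMorphism.Build _ _ (lin_ext f) (lin_extB f).

Lemma lin_ext_cell (T : finType) (V : zmodType) (f : T -> V) t :
  lin_ext f (cell t) = f t.
Proof.
rewrite /lin_ext (bigD1 t)//= ffunE eqxx mulr1z big1 ?addr0// => u /negPf ut.
by rewrite ffunE ut mulr0z.
Qed.

HB.instance Definition _ :=
  GRing.isZmodMorphism.Build _ _ bar_d2 (lin_extB _).
HB.instance Definition _ :=
  GRing.isZmodMorphism.Build _ _ bar_d3 (lin_extB _).

Lemma bar_d2d3 w : bar_d2 (bar_d3 w) = 0.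
Proof.
rewrite /bar_d2 {1}/bar_d3 [in X in lin_ext _ X]/lin_ext raddf_sum big1// => t _.
rewrite raddfMz; case: t => [[g h] k] /=; rewrite !(raddfB, raddfD)/=.
rewrite !lin_ext_cell mulgA; set a := cell g; set b := cell h; set d := cell k.
set e := cell (g * h)%g; set f := cell (h * k)%g; set m := cell (g * h * k)%g.
suff -> : d - f + b - (d - m + e) + (f - m + a) - (b - e + a) = 0 by rewrite mul0rz.
by apply/ffunP=> x; rewrite !ffunE; ring.
Qed.

Definition bar_Z2 : {pred chain (G * G)%type} := [pred z | bar_d2 z == 0].

Lemma bar_Z2_zmod_closed : zmod_closed bar_Z2.
Proof.
split=> [|x y]; rewrite !inE ?raddf0// raddfB/=.
by move=> /eqP-> /eqP->; rewrite subrr.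
Qed.

HB.instance Definition _ :=
  GRing.isZmodClosed.Build _ bar_Z2 bar_Z2_zmod_closed.

Definition cycle2 := {z : chain (G * G)%type | z \in bar_Z2}.

HB.instance Definition _ := SubChoice.on cycle2.
HB.instance Definition _ := [SubChoice_isSubZmodule of cycle2 by <:].

Definition bar_B2 : {pred cycle2} :=
  [pred z : cycle2 | `[< exists w, bar_d3 w = val z >]].

Lemma bar_B2_zmod_closed : zmod_closed bar_B2.
Proof.
split=> [|x y].
  by rewrite inE; apply/asboolP; exists 0; rewrite !raddf0.
rewrite !inE => /asboolP[v vx] /asboolP[w wy]; apply/asboolP.
by exists (v - w); rewrite !raddfB/= vx wy.
Qed.

HB.instance Definition _ :=
  GRing.isZmodClosed.Build _ bar_B2 bar_B2_zmod_closed.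

Definition H2 : zmodType := Quotient.quot bar_B2.

End BarHomology.

(* Main.v *)
Require Import Defs.
From HB Require Import structures.
From mathcomp Require Import all_boot all_order all_algebra.
From mathcomp Require Import all_fingroup all_solvable.
From mathcomp Require Import boolp zify ring.

(** Write E for the exterior square of G, bd : E -> G for the commutator map
    and L_k for the lower central series of G; G acts on E by conjugating both
    entries of a symbol.

    The engine is a form of the Hall-Petrescu collection formula. Relative to
    a filtration F of a group, with [F_a, F_b] <= F_(a+b), the polynomial
    sequences (those whose iterated difference quotients of order j have values
    in F_j) are closed under pointwise products: the Lazard-Leibman theorem,
    [poly_filtration]. A polynomial sequence f can thus be multiplied by powers
    c^-C(i,j), with c in F_j, until it vanishes at more and more initial
    points. If every element of F_j is killed by C(q,j) for all j > 1, these
    corrections are invisible at i = q, and f(0) = 1 entails f(q) = f(1)^q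
    ([polyseq_eval]).

    E is a crossed module over G, and L_k /\ G (the subgroup generated by the
    x /\ y with x in L_k) defines a filtration of E on which L_b acts trivially
    up to a shift by b ([actR_wedge_lcn]); it vanishes as soon as L_k = 1. Fix
    s > 0 and put F_j = L_(js) /\ G. For x in L_s the sequence i |-> x^i /\ y is
    polynomial: its difference quotients are of the form x^i.u with u fixed. If
    x^q = 1, its value at q is 1 /\ y = 1, whence (x /\ y)^q = 1; and
    i |-> u^i v^i being polynomial as well, this passes from the generators to
    all of L_s /\ G.

    With exp(G) = p^e and L_(p^n) = 1, a downward induction on s then shows that
    L_s /\ G is killed by p^(e + n - 1 - floor(log_p s)): the p-adic valuation
    of C(p^m,j) is at least m - v_p(j), and replacing s by js raises the floor
    of log_p s by at least v_p(j) ([wedge_lcn_exp]). The case s = 1 is the bound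
    on exp(E).

    For H_2, the bar 2-chains modulo boundaries carry a tautological 2-cocycle,
    hence give a central extension X of G. Commutators in X satisfy the
    relations of E, so they define a morphism E -> X whose image contains all
    commutators. In the abelianisation of X the class of a 2-chain z depends on
    its boundary only ([cext_ab_bar_d2]); hence the class of a cycle is in the
    image of E, and what kills E kills it. *)

Set Implicit Arguments.
Unset Strict Implicit.
Unset Printing Implicit Defensive.

Import GRing.Theory.
Local Open Scope group_scope.

(** * Polynomial sequences in a filtered group *)

Section PolynomialSequences.

Variable E : groupType.

Record filtration (F : nat -> E -> Prop) : Prop := Filtration {
  fil1 : forall k, F k 1;
  filM : forall k x y, F k x -> F k y -> F k (x * y);
  filV : forall k x, F k x -> F k x^-1;
  filS : forall k x, F k.+1 x -> F k x;
  filR : forall a b x y, F a x -> F b y -> F (a + b)%N [~ x, y] }.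

Variable F : nat -> E -> Prop.
Hypothesis filF : filtration F.

(** A truncated notion: only the first d difference quotients are constrained.
    The truncation order is what the closure properties are proved by induction
    on. *)
Fixpoint poly d k (f : nat -> E) : Prop :=
  (forall i, F k (f i)) /\
  if d is d'.+1 then poly d' k.+1 (fun i => f i.+1 * (f i)^-1) else True.

Definition polyseq k f := forall d, poly d k f.

Lemma poly_ext d k f g : f =1 g -> poly d k f -> poly d k g.
Proof. by move=> /funext ->. Qed.

Lemma poly_val d k f i : poly d k f -> F k (f i).
Proof. by case: d => [|d] []. Qed.

Lemma poly_pred d k f : poly d.+1 k f -> poly d k f.
Proof.
by elim: d k f => [|d IHd] k f [fF df]; split=> //; apply: IHd.
Qed.

Lemma poly_sub d k m f : (k <= m)%N -> poly d m f -> poly d k f.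
Proof.
move=> /subnK <-; elim: (m - k)%N => // j IHj; rewrite addSn => pf; apply: IHj.
elim: d (j + k)%N f pf => [|d IHd] l f [fF df];
  by split=> [i|]; [apply/(filS filF)/fF | try exact: IHd].
Qed.

Lemma poly1 d k : poly d k (fun=> 1).
Proof.
elim: d k => [|d IHd] k; (split; first by move=> i; apply: fil1) => //.
by apply: poly_ext (IHd k.+1) => i; rewrite invg1 mulg1.
Qed.

(** The Lazard-Leibman theorem: for each truncation order, polynomial sequences
    themselves form a filtration. The difference quotients of f g, f^-1 and
    [~ f, g] are products of conjugates of commutators of f, g and their own
    difference quotients; as everything is needed one order of truncation lower
    only, the induction is not circular. *)
Lemma poly_filtration d :
  [/\ forall k f g, poly d k f -> poly d k g -> poly d k (fun i => f i * g i),
      forall k f, poly d k f -> poly d k (fun i => (f i)^-1) &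
      forall a b f g, poly d a f -> poly d b g ->
        poly d (a + b)%N (fun i => [~ f i, g i])].
Proof.
elim: d => [|d [IHM IHV IHR]].
  split=> [k f g [fF _] [gF _]|k f [fF _]|a b f g [fF _] [gF _]]; split=> // i.
  - exact: filM.
  - exact: filV.
  - exact: filR.
have IHJ k m f g : poly d k f -> poly d m g -> poly d k (fun i => f i ^ g i).
  move=> pf pg; have pR := poly_sub (leq_addr m k) (IHR _ _ _ _ pf pg).
  by apply: poly_ext (IHM _ _ _ pf pR) => i; rewrite commgEl mulVKg.
split=> [k f g pf pg|k f pf|a b f g pf pg]; split.
- by move=> i; apply: filM => //; apply: poly_val; [apply: pf | apply: pg].
- have [[_ df] [_ dg]] := (pf, pg).
  apply: poly_ext (IHM _ _ _ df (IHJ _ _ _ _ dg (IHV _ _ (poly_pred pf)))) => i.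
  by rewrite conjgE /= !gnorm.
- by move=> i; apply: filV => //; apply: poly_val pf.
- have [_ df] := pf.
  apply: poly_ext (IHJ _ _ _ _ (IHV _ _ df) (poly_pred pf)) => i.
  by rewrite conjgE !gnorm.
- by move=> i; apply: filR => //; apply: poly_val; [apply: pf | apply: pg].
- have [[_ df] [_ dg]] := (pf, pg).
  have [pf' pg'] := (poly_pred pf, poly_pred pg).
  have sub := poly_sub.
  set u := fun i => f i.+1 * (f i)^-1 in df.
  set v := fun i => g i.+1 * (g i)^-1 in dg.
  have ug : poly d (a + b).+1 (fun i => [~ u i, g i]).
    by rewrite -addSn; apply: IHR.
  have fv : poly d (a + b).+1 (fun i => [~ f i, v i]).
    by rewrite -addnS; apply: IHR.
  have uv : poly d (a + b).+1 (fun i => [~ u i, v i]).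
    by apply: sub (IHR _ _ _ _ df dg); rewrite addSn ltnS leq_add2l leqW.
  have gR := IHM _ _ _ (sub _ _ _ _ (leq0n _) pg')
    (IHV _ _ (sub _ _ _ _ (leq0n _) (IHR _ _ _ _ pf' pg'))).
  (* With f(i+1) = u f and g(i+1) = v g, the difference quotient of [~ f, g] is
     [~ u, g]^f ([~ u, v]^f [~ f, v])^(g [~ f, g]^-1). *)
  apply: poly_ext (IHM _ _ _ (IHJ _ _ _ _ ug pf')
    (IHJ _ _ _ _ (IHM _ _ _ (IHJ _ _ _ _ uv pf') fv) gR)) => i.
  have -> : f i.+1 = u i * f i by rewrite /u mulgVK.
  have -> : g i.+1 = v i * g i by rewrite /v mulgVK.
  by rewrite /commg /conjg !gnorm.
Qed.

Lemma polyseqM k f g :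
  polyseq k f -> polyseq k g -> polyseq k (fun i => f i * g i).
Proof. by move=> pf pg d; have [+ _ _] := poly_filtration d; apply. Qed.

Lemma polyseqV k f : polyseq k f -> polyseq k (fun i => (f i)^-1).
Proof. by move=> pf d; have [_ + _] := poly_filtration d; apply. Qed.

Lemma filX k x n : F k x -> F k (x ^+ n).
Proof.
move=> Fx; elim: n => [|n IHn]; first by rewrite expg0; apply: fil1.
by rewrite expgS; apply: filM.
Qed.

Lemma fil_sub k m x : (k <= m)%N -> F m x -> F k x.
Proof.
move=> /subnK <-; elim: (m - k)%N => // j IHj Fx; exact/IHj/(filS filF).
Qed.

(** The difference quotient of i |-> x^C(i,j) is i |-> x^C(i,j-1), by Pascal's
    rule. *)
Lemma polyseq_bin k j x : F (k + j)%N x -> polyseq k (fun i => x ^+ 'C(i, j)).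
Proof.
move=> + d; elim: d k j => [|d IHd] k j Fx;
  (split; first by move=> i; apply/filX/(fil_sub (leq_addr j k)))=> //.
case: j Fx => [|j] Fx.
  by apply: poly_ext (poly1 d k.+1) => i; rewrite !bin0 mulgV.
apply: poly_ext (IHd k.+1 j _) => [i|]; last by rewrite addSnnS.
by rewrite binS addnC expgnDr mulgK.
Qed.

(** The first possibly nontrivial value of a sequence is also its iterated
    difference quotient of that order at 0. *)
Lemma poly_lead m k f :
  poly m k f -> (forall i, (i < m)%N -> f i = 1) -> F (k + m)%N (f m).
Proof.
elim: m k f => [|m IHm] k f [fF df] f1; first by rewrite addn0.
rewrite -addSnnS.
have := IHm _ _ df; rewrite (f1 m) // invg1 mulg1; apply=> i im.
by rewrite !f1 ?mulgV // ltnW.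
Qed.

Section Evaluation.

Variable q : nat.
Hypothesis killF :
  forall j x, (1 < j)%N -> F j x -> x ^+ 'C(q, j) = 1.

(** Dividing by the Taylor terms f(m)^C(i,m), for m = 2, 3, ..., kills the
    values of f one after the other without changing its value at q; once m
    exceeds q nothing is left there. *)
Lemma polyseq_eval1 f : polyseq 0 f -> f 0 = 1 -> f 1%N = 1 -> f q = 1.
Proof.
move=> pf f0 f1.
suff H d m g : (1 < m)%N -> (q < d + m)%N -> polyseq 0 g ->
    (forall i, (i < m)%N -> g i = 1) -> g q = 1.
  apply: (H q.+1 2%N) => //; first by rewrite addSn ltnS leq_addr.
  by case=> [|[|]].
elim: d m g => [|d IHd] m g m1 qm pg g1; first exact: g1.
pose x := g m; have Fx : F m x := poly_lead (pg m) g1.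
have gq : (x ^+ 'C(q, m))^-1 * g q = 1.
  apply: (IHd m.+1 (fun i => (x ^+ 'C(i, m))^-1 * g i)) => //.
  - exact: ltnW.
  - by rewrite addnS.
  - by apply: polyseqM => //; apply/polyseqV/polyseq_bin.
  move=> i; rewrite ltnS leq_eqVlt => /predU1P[->|im].
    by rewrite binn expg1 mulVg.
  by rewrite g1 // bin_small // expg0 invg1 mulg1.
by move: gq; rewrite killF // invg1 mul1g.
Qed.

(** The Hall-Petrescu formula when all its correction terms vanish. *)
Lemma polyseq_eval f : polyseq 0 f -> f 0 = 1 -> f q = f 1%N ^+ q.
Proof.
move=> pf f0; set x := f 1%N.
have Fx : F 1 x by apply: (@poly_lead 1 0 f (pf 1%N)) => -[].
apply: divg1_eq; rewrite -{2}[q]bin1.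
apply: (polyseq_eval1 (f := fun i => f i * x ^- 'C(i, 1))).
- by apply: polyseqM => //; apply/polyseqV/polyseq_bin.
- by rewrite f0 expg0 invg1 mulg1.
- by rewrite mulgV.
Qed.

(** The sequence i |-> x^i y^i is polynomial, with value x y at 1. *)
Lemma expgM_filtration x y : F 1 x -> F 1 y -> (x * y) ^+ q = x ^+ q * y ^+ q.
Proof.
move=> Fx Fy; rewrite -[x ^+ q]/((fun i => x ^+ i) q) -{2 3}[q]bin1.
rewrite -(@polyseq_eval (fun i => x ^+ 'C(i, 1) * y ^+ 'C(i, 1))) //.
  by apply: polyseqM; apply: polyseq_bin.
by rewrite mulg1.
Qed.

End Evaluation.

End PolynomialSequences.

(** * The exterior square as a crossed module *)

Section ExteriorSquareTheory.

Variable G : groupType.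

Local Notation E := (ext_square G).

Definition wedge (g h : G) : E := ext_pi (TWedge g h).

Lemma wedgeMl g g' h :
  wedge (g * g') h = wedge (g * g' * g^-1) (g * h * g^-1) * wedge g h.
Proof. by rewrite /wedge [RHS]ext_piM; apply/ext_piP/cong_wedgeMl. Qed.

Lemma wedgeMr g h h' :
  wedge g (h * h') = wedge g h * wedge (h * g * h^-1) (h * h' * h^-1).
Proof. by rewrite /wedge [RHS]ext_piM; apply/ext_piP/cong_wedgeMr. Qed.

Lemma wedgegg g : wedge g g = 1.
Proof. exact/ext_piP/cong_wedgegg. Qed.

Lemma ext_square_ind (P : E -> Prop) :
  (forall g h, P (wedge g h)) -> P 1 -> (forall x, P x -> P x^-1) ->
  (forall x y, P x -> P y -> P (x * y)) -> forall x, P x.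
Proof.
move=> Pw P1 PV PM x; have [a ->] := ext_pi_surj x.
elim: a => [g h||a IHa|a IHa b IHb] //; first exact: Pw.
  by rewrite -ext_piV; apply: PV.
by rewrite -ext_piM; apply: PM.
Qed.

(** The commutator map, the action of G and the comparison with a central
    extension all arise from this universal property. *)
Section UniversalProperty.

Variables (H : groupType) (w : G -> G -> H).

Fixpoint term_lift (t : ext_term G) : H :=
  match t with
  | TWedge g h => w g h
  | TOne => 1
  | TInv a => (term_lift a)^-1
  | TMul a b => term_lift a * term_lift b
  end.

Definition ext_lift (x : E) : H := term_lift (generic_quotient.repr x).

Hypothesis wMl : forall g g' h,
  w (g * g') h = w (g * g' * g^-1) (g * h * g^-1) * w g h.
Hypothesis wMr : forall g h h',
  w g (h * h') = w g h * w (h * g * h^-1) (h * h' * h^-1).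
Hypothesis wgg : forall g, w g g = 1.

Lemma term_lift_cong a b : ext_cong a b -> term_lift a = term_lift b.
Proof.
elim=> //= {a b}.
- by move=> a b c _ -> _ ->.
- by move=> a a' _ ->.
- by move=> a a' b b' _ -> _ ->.
- by move=> a b c; rewrite mulgA.
- by move=> a; rewrite mul1g.
- by move=> a; rewrite mulg1.
- by move=> a; rewrite mulVg.
- by move=> a; rewrite mulgV.
Qed.

Lemma ext_lift_pi a : ext_lift (ext_pi a) = term_lift a.
Proof. exact/term_lift_cong/ext_reprP. Qed.

Lemma ext_lift_wedge g h : ext_lift (wedge g h) = w g h.
Proof. by rewrite ext_lift_pi. Qed.

Lemma ext_lift1 : ext_lift 1 = 1.
Proof. by rewrite ext_lift_pi. Qed.

Lemma ext_liftM : {morph ext_lift : x y / x * y}.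
Proof.
move=> x y; have [[a ->] [b ->]] := (ext_pi_surj x, ext_pi_surj y).
by rewrite [ext_pi a * ext_pi b]ext_piM !ext_lift_pi.
Qed.

Lemma ext_liftV : {morph ext_lift : x / x^-1}.
Proof.
move=> x; have [a ->] := ext_pi_surj x.
by rewrite [(ext_pi a)^-1]ext_piV !ext_lift_pi.
Qed.

End UniversalProperty.

(** The commutator map, which is the boundary of the crossed module. *)
Definition bd : E -> G := ext_lift (fun g h => g * h * g^-1 * h^-1).

Let bdMl (g g' h : G) : g * g' * h * (g * g')^-1 * h^-1 =
  (g * g' * g^-1) * (g * h * g^-1) * (g * g' * g^-1)^-1 * (g * h * g^-1)^-1
    * (g * h * g^-1 * h^-1).
Proof. by rewrite !gnorm. Qed.
Let bdMr (g h h' : G) : g * (h * h') * g^-1 * (h * h')^-1 =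
  g * h * g^-1 * h^-1 * ((h * g * h^-1) * (h * h' * h^-1) * (h * g * h^-1)^-1
    * (h * h' * h^-1)^-1).
Proof. by rewrite !gnorm. Qed.
Let bdgg (g : G) : g * g * g^-1 * g^-1 = 1.
Proof. by rewrite !gnorm. Qed.

Lemma bd_wedge g h : bd (wedge g h) = g * h * g^-1 * h^-1.
Proof. exact: ext_lift_wedge. Qed.

Lemma bd1 : bd 1 = 1. Proof. exact: ext_lift1. Qed.
Lemma bdM : {morph bd : x y / x * y}. Proof. exact: ext_liftM. Qed.
Lemma bdV : {morph bd : x / x^-1}. Proof. exact: ext_liftV. Qed.

Definition act (k : G) : E -> E :=
  ext_lift (fun g h => wedge (k * g * k^-1) (k * h * k^-1)).

Section ActionMorphism.
Variable k : G.
Local Notation w := (fun g h => wedge (k * g * k^-1) (k * h * k^-1)).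
Let cM (g h : G) : k * (g * h) * k^-1 = k * g * k^-1 * (k * h * k^-1).
Proof. by rewrite !gnorm. Qed.
Let cV (g : G) : k * g^-1 * k^-1 = (k * g * k^-1)^-1.
Proof. by rewrite !gnorm. Qed.
Let wMl (g g' h : G) : w (g * g') h = w (g * g' * g^-1) (g * h * g^-1) * w g h.
Proof. by rewrite /= !cM cV wedgeMl. Qed.
Let wMr (g h h' : G) : w g (h * h') = w g h * w (h * g * h^-1) (h * h' * h^-1).
Proof. by rewrite /= !cM cV wedgeMr. Qed.
Let wgg (g : G) : w g g = 1.
Proof. exact: wedgegg. Qed.

Lemma act_wedge g h : act k (wedge g h) = wedge (k * g * k^-1) (k * h * k^-1).
Proof. exact: ext_lift_wedge. Qed.
Lemma act1 : act k 1 = 1. Proof. exact: ext_lift1. Qed.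
Lemma actM : {morph act k : x y / x * y}. Proof. exact: ext_liftM. Qed.
Lemma actV : {morph act k : x / x^-1}. Proof. exact: ext_liftV. Qed.
End ActionMorphism.

Lemma actgM k l x : act (k * l) x = act k (act l x).
Proof.
elim/ext_square_ind: x => [g h||x IH|x y IHx IHy].
- by rewrite !act_wedge !gnorm.
- by rewrite !act1.
- by rewrite !actV IH.
- by rewrite !actM IHx IHy.
Qed.

Lemma act1g x : act 1 x = x.
Proof.
elim/ext_square_ind: x => [g h||x IH|x y IHx IHy].
- by rewrite !act_wedge !gnorm.
- by rewrite !act1.
- by rewrite !actV IH.
- by rewrite !actM IHx IHy.
Qed.

Lemma actKV k x : act k (act k^-1 x) = x.
Proof. by rewrite -actgM mulgV act1g. Qed.

Lemma wedgeMl_act g g' h : wedge (g * g') h = act g (wedge g' h) * wedge g h.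
Proof. by rewrite act_wedge wedgeMl. Qed.

Lemma wedgeMr_act g h h' : wedge g (h * h') = wedge g h * act h (wedge g h').
Proof. by rewrite act_wedge wedgeMr. Qed.

Lemma wedge1g h : wedge 1 h = 1.
Proof.
apply: (mulgI (wedge 1 h)).
by rewrite mulg1 -{1}[wedge 1 h]act1g -wedgeMl_act mulg1.
Qed.

(** The Peiffer identity. For a symbol x = g /\ h, it comes from expanding
    (g g') /\ (h h') in the two possible orders, which gives
    x . (hg.y) . x^-1 = gh.y for y = g' /\ h'. *)
Lemma peiffer x y : x * y * x^-1 = act (bd x) y.
Proof.
elim/ext_square_ind: x y => [g h|y|x IH y|x z IHx IHz y].
- move=> y; rewrite bd_wedge; apply: (canLR (mulgK _)).
  have -> : g * h * g^-1 * h^-1 = g * h * (h * g)^-1 by rewrite !gnorm.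
  rewrite actgM -[y in LHS](actKV (h * g)); move: (act _ y) => {}y.
  suff H : wedge g h * act (h * g) y * (wedge g h)^-1 = act (g * h) y.
    by rewrite -H mulgVK.
  elim/ext_square_ind: y => [g' h'||y IH|y z IHy IHz].
  + have := wedgeMl_act g g' (h * h').
    rewrite (wedgeMr_act (g * g')) !wedgeMr_act !wedgeMl_act !actM.
    rewrite -!actgM -!mulgA.
    move=> /mulgI /(congr1 (fun x => x * (act h (wedge g h'))^-1)).
    by rewrite !mulgA !mulgK => ->; rewrite mulgK.
  + by rewrite !act1 mulg1 mulgV.
  + by rewrite !actV -IH !gnorm.
  + by rewrite !actM -IHy -IHz !gnorm.
- by rewrite bd1 act1g !gnorm.
- by rewrite bdV -[y in LHS](actKV (bd x)) -IH !gnorm.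
- by rewrite bdM actgM -IHz -IHx !gnorm.
Qed.

Lemma wedgeVl g h : wedge g^-1 h = (act g^-1 (wedge g h))^-1.
Proof.
by apply/esym/mulg1_eq; rewrite -wedgeMl_act mulVg wedge1g.
Qed.

(** For a symbol x = g /\ h, expand [g, h] /\ k as a product starting with g;
    this leaves a conjugate of g /\ k^h, which the two expansions of
    g /\ h k^h = g /\ k h compute, and the Peiffer identity disposes of the
    conjugation. *)
Lemma wedge_bd x k : wedge (bd x) k = x * (act k x)^-1.
Proof.
elim/ext_square_ind: x => [g h||x IH|x y IHx IHy].
- set e := wedge g h; pose k' := h^-1 * k * h.
  have Xe : act h (wedge g k') = e^-1 * wedge g k * act k e.
    rewrite -mulgA -wedgeMr_act -[k * h](mulKVg h) [h^-1 * _]mulgA -/k'.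
    by rewrite wedgeMr_act mulKg.
  have -> : bd e = g * (h * g^-1 * h^-1) by rewrite bd_wedge !mulgA.
  have -> : wedge (g * (h * g^-1 * h^-1)) k =
      (act (g * h * g^-1) (wedge g k'))^-1 * wedge g k.
    rewrite wedgeMl_act; congr (_ * _).
    have -> : wedge (h * g^-1 * h^-1) k = act h (wedge g^-1 k').
      by rewrite act_wedge; congr wedge; rewrite /k' !gnorm.
    by rewrite wedgeVl !actV -!actgM.
  have -> : g * h * g^-1 = bd e * h by rewrite bd_wedge !gnorm.
  by rewrite actgM -peiffer Xe !gnorm.
- by rewrite bd1 wedge1g act1 invg1 mulg1.
- by rewrite bdV wedgeVl IH -bdV -peiffer actV !gnorm.
- by rewrite bdM wedgeMl_act IHx IHy -peiffer actM !gnorm.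
Qed.

End ExteriorSquareTheory.

(** * The filtration of the exterior square by the lower central series *)

Section LowerCentralFiltration.

Variable gT : finGroupType.
Local Notation E := (ext_square gT).
Local Notation L k := ('L_k([set: gT])).

(** The image of L_k /\ G in the exterior square. The boundary maps it into
    L_(k+1); giving it the weight k, and not k + 1, makes L_(js) /\ G the term of
    weight j of a filtration for each s. *)
Inductive wedge_lcn (k : nat) : E -> Prop :=
| wedge_lcn_wedge x y : x \in L k -> wedge_lcn k (wedge x y)
| wedge_lcn_1 : wedge_lcn k 1
| wedge_lcn_V u : wedge_lcn k u -> wedge_lcn k u^-1
| wedge_lcn_M u v : wedge_lcn k u -> wedge_lcn k v -> wedge_lcn k (u * v).

Lemma mem_lcnR k x y : x \in L k -> x * y * x^-1 * y^-1 \in L k.+1.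
Proof.
move=> Lx; have -> : x * y * x^-1 * y^-1 = [~ x^-1, y^-1].
  by rewrite /commg /conjg !gnorm.
exact: (subsetP (lcnSnS k _)) _ (mem_commg (groupVr Lx) (in_setT _)).
Qed.

Lemma mem_lcnJ k x y : x \in L k -> y * x * y^-1 \in L k.
Proof.
move=> Lx; have -> : y * x * y^-1 = x ^ y^-1 by rewrite conjgE invgK mulgA.
by rewrite memJ_norm // (subsetP (lcn_norm k _)) // inE.
Qed.

Lemma wedge_lcn_sub k m u : (k <= m)%N -> wedge_lcn m u -> wedge_lcn k u.
Proof.
move=> km; elim=> {u} [x y Lx||u _|u v _ IHu _]; last exact: wedge_lcn_M.
- exact/wedge_lcn_wedge/(subsetP (lcn_sub_leq _ km)).
- exact: wedge_lcn_1.
- exact: wedge_lcn_V.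
Qed.

Lemma bd_wedge_lcn k u : wedge_lcn k u -> bd u \in L k.+1.
Proof.
elim=> {u} [x y Lx||u _|u v _ IHu _ IHv].
- by rewrite bd_wedge mem_lcnR.
- by rewrite bd1 group1.
- by rewrite bdV groupV.
- by rewrite bdM groupM.
Qed.

Lemma act_wedge_lcn k g u : wedge_lcn k u -> wedge_lcn k (act g u).
Proof.
elim=> {u} [x y Lx||u _|u v _ IHu _ IHv].
- by rewrite act_wedge; apply/wedge_lcn_wedge/mem_lcnJ.
- by rewrite act1; apply: wedge_lcn_1.
- by rewrite actV; apply: wedge_lcn_V.
- by rewrite actM; apply: wedge_lcn_M.
Qed.

(** By [wedge_bd], the quotient of g.u by u is the inverse of bd u /\ g. *)
Lemma actR1_wedge_lcn a g u : wedge_lcn a u -> wedge_lcn a.+1 (act g u * u^-1).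
Proof.
move=> Du; have -> : act g u * u^-1 = (wedge (bd u) g)^-1.
  by rewrite wedge_bd invgM invgK.
exact/wedge_lcn_V/wedge_lcn_wedge/bd_wedge_lcn.
Qed.

(** The three subgroups lemma: L_b is generated by commutators [x, y] with x in
    L_(b-1), and x y and y x act in the same way modulo L_(a+b) /\ G as soon as
    the displacements by x and by y commute modulo that subgroup. *)
Lemma actR_wedge_lcn a b g u :
  g \in L b -> wedge_lcn a u -> wedge_lcn (a + b) (act g u * u^-1).
Proof.
case: b => [|b].
  move=> _ Du; rewrite addn0; apply: (wedge_lcn_sub (leqnSn a)).
  exact: actR1_wedge_lcn.
elim: b a g u => [|b IHb] a g u.
  by rewrite addn1 => _; apply: actR1_wedge_lcn.
pose K := [set g |
  `[< forall u, wedge_lcn a u -> wedge_lcn (a + b.+2) (act g u * u^-1) >]].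
have gK : group_set K.
  apply/group_setP; split=> [|x y]; rewrite !inE.
    by apply/asboolP=> v Dv; rewrite act1g mulgV; apply: wedge_lcn_1.
  move=> /asboolP Kx /asboolP Ky; apply/asboolP=> v Dv.
  have -> : act (x * y) v * v^-1 =
      act x (act y v * v^-1) * (act x v * v^-1).
    by rewrite actM actV -actgM !gnorm.
  by apply: wedge_lcn_M; [apply/act_wedge_lcn/Ky | apply: Kx].
rewrite lcnSn => + Du; suff /subsetP sK : [~: L b.+1, [set: gT]] \subset K.
  by move=> /sK; rewrite inE => /asboolP; apply.
rewrite -[K]/(gval (Group gK)) gen_subG.
apply/subsetP=> _ /imset2P[x y Lx _ ->].
have {}Lx : x^-1 \in L b.+1 by rewrite groupV.
have -> : [~ x, y] = x^-1 * y^-1 * (y^-1 * x^-1)^-1.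
  by rewrite /commg /conjg !gnorm.
move: x^-1 y^-1 Lx => {}x {}y Lx; rewrite inE /=; apply/asboolP=> v Dv.
rewrite actgM; set t := act (y * x)^-1 v.
have Dt : wedge_lcn a t by apply: act_wedge_lcn.
have -> : v = act (y * x) t by rewrite actKV.
move: t Dt => {u Du v Dv}u Du.
(* The displacements v of u by y and w of u by x: then x.(y.u) = (x.v) w u and
   y.(x.u) = (y.w) v u. *)
pose v := act y u * u^-1; pose w := act x u * u^-1.
have Dv : wedge_lcn a.+1 v by apply: actR1_wedge_lcn.
have Dw : wedge_lcn (a + b.+1) w by apply: IHb.
have Dxv : wedge_lcn (a + b.+2) (act x v * v^-1).
  by rewrite -addSnnS; apply: IHb.
have Dyw : wedge_lcn (a + b.+2) (act y w * w^-1).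
  by rewrite addnS; apply: actR1_wedge_lcn.
have Dvw : wedge_lcn (a + b.+2) (v * w * v^-1 * w^-1).
  by rewrite peiffer addnS; apply: actR1_wedge_lcn.
have -> : act (x * y) u * (act (y * x) u)^-1 =
    act x v * v^-1 * (v * w * v^-1 * w^-1) * (act y w * w^-1)^-1.
  have wE : w * u = act x u by rewrite mulgVK.
  have vE : v * u = act y u by rewrite mulgVK.
  have -> : act (x * y) u = act x v * (w * u) by rewrite wE -actM vE actgM.
  have -> : act (y * x) u = act y w * (v * u) by rewrite vE -actM wE actgM.
  by rewrite !gnorm.
by apply: wedge_lcn_M (wedge_lcn_V _); first apply: wedge_lcn_M.
Qed.

Lemma wedge_lcnR a b u v :
  wedge_lcn a u -> wedge_lcn b v -> wedge_lcn (a + b) [~ u, v].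
Proof.
move=> /wedge_lcn_V Du /wedge_lcn_V Dv.
have -> : [~ u, v] = u^-1 * v^-1 * u^-1^-1 * v^-1^-1.
  by rewrite /commg /conjg !gnorm.
rewrite peiffer addnC; apply: actR_wedge_lcn => //.
exact/(subsetP (lcn_sub_leq _ (leqnSn a)))/bd_wedge_lcn.
Qed.

Lemma wedge_lcn_filtration s : filtration (fun j => wedge_lcn (j * s)).
Proof.
split=> [k|k x y|k x|k x|a b x y].
- exact: wedge_lcn_1.
- exact: wedge_lcn_M.
- exact: wedge_lcn_V.
- by apply: wedge_lcn_sub; rewrite leq_mul2r leqnSn orbT.
- by rewrite mulnDl; apply: wedge_lcnR.
Qed.

Lemma wedge_lcn_trivial k u : L k = 1 -> wedge_lcn k u -> u = 1.
Proof.
move=> Lk1; elim=> {u} [x y Lx||u _ ->|u v _ -> _ ->] //.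
- by move: Lx; rewrite Lk1 => /set1P ->; apply: wedge1g.
- exact: invg1.
- exact: mulg1.
Qed.

(** The difference quotient of i |-> g^i.u is i |-> g^i.u', where u' is the
    quotient of g.u by u, which lies s steps deeper. *)
Lemma act_polyseq s g u k : g \in L s -> wedge_lcn (k * s) u ->
  polyseq (fun j => wedge_lcn (j * s)) k (fun i => act (g ^+ i) u).
Proof.
move=> Lg + d; elim: d k u => [|d IHd] k u Du;
  (split; first by move=> i; apply: act_wedge_lcn) => //.
have D'u : wedge_lcn (k.+1 * s) (act g u * u^-1).
  by rewrite mulSnr; apply: actR_wedge_lcn.
apply: poly_ext (IHd k.+1 _ D'u) => i.
by rewrite actM actV -actgM -expgSr.
Qed.

(** Since g^(i+1) /\ h = g^i.(g /\ h) (g^i /\ h), the difference quotient is the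
    orbit of g /\ h under the powers of g. *)
Lemma wedge_polyseq s g h : g \in L s ->
  polyseq (fun j => wedge_lcn (j * s)) 0 (fun i => wedge (g ^+ i) h).
Proof.
move=> Lg d; have Fg i : wedge_lcn (0 * s) (wedge (g ^+ i) h).
  by apply: wedge_lcn_wedge; rewrite mul0n inE.
case: d => [|d]; (split; first exact: Fg) => //.
apply: poly_ext (act_polyseq Lg (k := 1) _ d) => [i|]; last first.
  by rewrite mul1n; apply: (@wedge_lcn_wedge s g h).
by rewrite /= expgSr wedgeMl_act mulgK.
Qed.

(** At i = q the polynomial sequence x^i /\ y takes the value 1 /\ y = 1 and, by
    the evaluation formula, the value (x /\ y)^q. *)
Lemma wedge_lcn_exp_step s q : (forall x : gT, x ^+ q = 1) ->
  (forall j u, (1 < j)%N -> wedge_lcn (j * s) u -> u ^+ 'C(q, j) = 1) ->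
  forall u, wedge_lcn s u -> u ^+ q = 1.
Proof.
move=> Gq kill u; have fil := wedge_lcn_filtration s.
elim=> {u} [x y Lx||u _ IHu|u v Du IHu Dv IHv].
- have := polyseq_eval fil kill (wedge_polyseq y Lx).
  by rewrite Gq expg0 expg1 wedge1g => <-.
- exact: expg1n.
- by rewrite expVgn IHu invg1.
- by rewrite (expgM_filtration fil kill) ?IHu ?IHv ?mulg1 //= mul1n.
Qed.

End LowerCentralFiltration.

(** * The exponent of the exterior square *)

Lemma expg_dvdn (H : groupType) (x : H) m n :
  (m %| n)%N -> x ^+ m = 1 -> x ^+ n = 1.
Proof. by move=> /dvdnP[k ->] xm; rewrite mulnC expgnA xm expg1n. Qed.

(** A least exponent divides all exponents, by Euclidean division. *)
Lemma least_pos_dvdn (P : nat -> Prop) m : (0 < m)%N -> P m ->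
  (forall a b, P a -> P b -> P (a %% b)) -> (least_pos P %| m)%N.
Proof.
move=> m0 Pm Pmod; have [l0 Pl lmin] := least_posP (ex_intro2 _ _ m m0 Pm).
apply/contraT; rewrite /dvdn -lt0n => r0.
by have := lmin _ r0 (Pmod _ _ Pm Pl); rewrite leqNgt ltn_mod l0.
Qed.

Lemma group_exp_dvdn (H : groupType) m :
  (0 < m)%N -> (forall h : H, h ^+ m = 1) -> (group_exp H %| m)%N.
Proof.
move=> m0 Hm; apply: least_pos_dvdn => // a b Ha Hb h.
by have := Ha h; rewrite {1}(divn_eq a b) mulnC expgnDr expgnA Hb expg1n mul1g.
Qed.

Lemma zmod_exp_dvdn (A : zmodType) m :
  (0 < m)%N -> (forall a : A, a *+ m = 0)%R -> (zmod_exp A %| m)%N.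
Proof.
move=> m0 Am; apply: least_pos_dvdn => // a b Ha Hb x.
have := Ha x; rewrite {1}(divn_eq a b) mulnC GRing.mulrnDr GRing.mulrnA Hb.
by rewrite GRing.mul0rn GRing.add0r.
Qed.

(** Because j C(p^m, j) = p^m C(p^m - 1, j - 1). *)
Lemma dvdn_bin_pexp p m j : prime p -> (0 < j)%N ->
  (p ^ (m - logn p j) %| 'C(p ^ m, j))%N.
Proof.
move=> p_pr j0; have [C0|C0] := posnP 'C(p ^ m, j); first by rewrite C0 dvdn0.
rewrite pfactor_dvdn // leq_subLR -lognM // -pfactor_dvdn ?muln_gt0 ?j0 //.
by case: j j0 C0 => // j _ _; rewrite -mul_bin_diag dvdn_mulr.
Qed.

Section ExponentBound.

Variables (p e n : nat) (gT : finGroupType).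
Hypothesis p_pr : prime p.
Hypothesis Ge : forall x : gT, x ^+ (p ^ e) = 1.
Hypothesis Gn : 'L_(p ^ n)([set: gT]) = 1.

(** Downward induction on s, starting from s >= p^n where the subgroup is
    trivial. In the step, C(p^m, j) with m = e + n - 1 - floor(log_p s) is a
    multiple of p^(m - v_p(j)), which by induction kills L_(js) /\ G because
    p^(floor(log_p s) + v_p(j)) <= j s. *)
Lemma wedge_lcn_exp s u : (0 < s)%N -> wedge_lcn s u ->
  u ^+ (p ^ (e + (n.-1 - trunc_log p s))) = 1 :> ext_square gT.
Proof.
have p1 := prime_gt1 p_pr.
have triv k (v : ext_square gT) : (p ^ n <= k)%N -> wedge_lcn k v -> v = 1.
  by move=> nk; apply: wedge_lcn_trivial; apply/trivgP; rewrite -Gn lcn_sub_leq.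
have [d] := ubnP (p ^ n - s); elim: d s u => // d IHd s u.
rewrite ltnS => ns s0 Du.
have [/triv/(_ Du) -> | sn] := leqP (p ^ n) s; first by rewrite expg1n.
apply: wedge_lcn_exp_step Du => [x|j {}u j1 Du].
  by rewrite expnD expgnA Ge expg1n.
have [/triv/(_ Du) -> | jn] := leqP (p ^ n) (j * s); first by rewrite expg1n.
have j0 : (0 < j)%N := ltnW j1.
have js0 : (0 < j * s)%N by rewrite muln_gt0 j0.
have sjs : (s < j * s)%N by rewrite ltn_Pmull.
have {}IHd := IHd _ _ (leq_trans (ltn_sub2l sn sjs) ns) js0 Du.
apply: expg_dvdn IHd; apply: dvdn_trans (dvdn_bin_pexp _ p_pr j0).
rewrite dvdn_exp2l //.
have le_log : (trunc_log p s + logn p j <= trunc_log p (j * s))%N.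
  apply: trunc_log_max => //; rewrite expnD mulnC leq_mul ?trunc_logP //.
  exact/dvdn_leq/pfactor_dvdnn.
have : (trunc_log p (j * s) <= n.-1)%N.
  rewrite -ltnS; apply: leq_trans (leqSpred n).
  by rewrite -(ltn_exp2l _ _ p1); apply: leq_ltn_trans jn; apply: trunc_logP.
move: le_log; lia.
Qed.

Lemma ext_square_expg (u : ext_square gT) : u ^+ (p ^ n.-1 * p ^ e) = 1.
Proof.
rewrite mulnC -expnD -[n.-1]subn0 -(trunc_log1 p).
apply: wedge_lcn_exp => //.
elim/ext_square_ind: u => [g h||x|x y].
- by apply: wedge_lcn_wedge; rewrite inE.
- exact: wedge_lcn_1.
- exact: wedge_lcn_V.
- exact: wedge_lcn_M.
Qed.

End ExponentBound.

(** * Abelianisation and central extensions *)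

(** The quotient of a group by a subgroup K that contains all commutators,
    written additively, so that Z-linear maps from a free module to it are given
    by their values on a basis. *)
Section AbelianQuotient.

Variable H : groupType.

Record abelianizer := Abelianizer {
  abz :> H -> Prop;
  abz1 : abz 1;
  abzM : forall x y, abz x -> abz y -> abz (x * y);
  abzV : forall x, abz x -> abz x^-1;
  abzR : forall x y, abz (x * y * x^-1 * y^-1) }.

Variable K : abelianizer.

Lemma abzJ x y : K x -> K (y * x * y^-1).
Proof.
move=> Kx; have -> : y * x * y^-1 = (y * x * y^-1 * x^-1) * x by rewrite mulgVK.
exact/abzM/Kx/abzR.
Qed.

Definition abz_rel : rel H := fun x y => `[< K (x * y^-1) >].

Lemma abz_relP : equiv_class_of abz_rel.
Proof.
split=> [x|x y|y x z].
- by apply/asboolP; rewrite mulgV; apply: abz1.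
- by apply/asboolP/asboolP=> /abzV; rewrite invgM invgK.
- move=> /asboolP Kxy /asboolP Kyz; apply/asboolP.
  by have := abzM Kxy Kyz; rewrite !gnorm.
Qed.

Canonical abz_equiv := EquivRelPack abz_relP.
Canonical abz_encModRel := defaultEncModRel abz_rel.

Definition abz_quot := {eq_quot abz_rel}%qT.
HB.instance Definition _ := EqQuotient.on abz_quot.
HB.instance Definition _ := Choice.on abz_quot.

Definition abz_pi (x : H) : abz_quot := (\pi_abz_quot x)%qT.

Lemma abz_piP x y : abz_pi x = abz_pi y <-> K (x * y^-1).
Proof. by split=> [/eqmodP/asboolP//|Kxy]; apply/eqmodP/asboolP. Qed.

Lemma abz_reprP x : K (generic_quotient.repr (abz_pi x) * x^-1).
Proof. by apply/abz_piP; rewrite /abz_pi reprK. Qed.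

Lemma abz_pi_surj (v : abz_quot) : exists x, v = abz_pi x.
Proof. by exists (generic_quotient.repr v); rewrite /abz_pi reprK. Qed.

Definition abz_zero := abz_pi 1.
Definition abz_opp (v : abz_quot) := abz_pi (generic_quotient.repr v)^-1.
Definition abz_add (u v : abz_quot) :=
  abz_pi (generic_quotient.repr u * generic_quotient.repr v).

Lemma abz_oppE x : abz_opp (abz_pi x) = abz_pi x^-1.
Proof.
apply/abz_piP; move: (generic_quotient.repr _) (abz_reprP x) => y Kyx.
by have := abzJ x^-1 (abzV Kyx); rewrite !gnorm.
Qed.

Lemma abz_addE x y : abz_add (abz_pi x) (abz_pi y) = abz_pi (x * y).
Proof.
apply/abz_piP; move: (abz_reprP x) (abz_reprP y).
move: (generic_quotient.repr _) => x'; move: (generic_quotient.repr _) => y'.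
by move=> Kx Ky; have := abzM (abzJ x' Ky) Kx; rewrite !gnorm.
Qed.

Lemma abz_addA : associative abz_add.
Proof.
move=> u v w; have [[x ->] [y ->] [z ->]] :=
  And3 (abz_pi_surj u) (abz_pi_surj v) (abz_pi_surj w).
by rewrite !abz_addE mulgA.
Qed.

Lemma abz_addC : commutative abz_add.
Proof.
move=> u v; have [[x ->] [y ->]] := (abz_pi_surj u, abz_pi_surj v).
by rewrite !abz_addE; apply/abz_piP; rewrite invgM !mulgA; apply: abzR.
Qed.

Lemma abz_add0 : left_id abz_zero abz_add.
Proof.
by move=> u; have [x ->] := abz_pi_surj u; rewrite abz_addE mul1g.
Qed.

Lemma abz_addN : left_inverse abz_zero abz_opp abz_add.
Proof.
by move=> u; have [x ->] := abz_pi_surj u; rewrite abz_oppE abz_addE mulVg.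
Qed.

HB.instance Definition _ :=
  GRing.isZmodule.Build abz_quot abz_addA abz_addC abz_add0 abz_addN.

Lemma abz_piM x y : abz_pi (x * y) = (abz_pi x + abz_pi y)%R.
Proof. by rewrite -abz_addE. Qed.

Lemma abz_pi_eq0 x : abz_pi x = 0%R <-> K x.
Proof.
by split=> [/abz_piP|Kx]; [|apply/abz_piP]; rewrite invg1 mulg1.
Qed.

End AbelianQuotient.

(** The extension of G by A attached to a 2-cocycle f that need not be
    normalised: its identity is (- f(1,1), 1), and A embeds as the pairs
    (a - f(1,1), 1). *)
Section CentralExtension.

Variables (G : groupType) (A : zmodType).

Record cocycle := Cocycle {
  coc :> G -> G -> A;
  cocP : forall g h k,
    (coc h k + coc g (h * k)%g = coc (g * h)%g k + coc g h)%R }.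

Variable f : cocycle.

Definition cext : Type := (A * G)%type.
HB.instance Definition _ := Choice.copy cext (A * G)%type.

Lemma coc1g g : f 1 g = f 1 1.
Proof. by have := cocP f 1 1 g; rewrite !mul1g => /addrI. Qed.

Lemma cocg1 g : f g 1 = f 1 1.
Proof. by have := cocP f g 1 1; rewrite !mulg1 [RHS]addrC => /addIr. Qed.

Lemma cocgV g : f g g^-1 = f g^-1 g.
Proof.
have := cocP f g g^-1 g; rewrite mulVg mulgV coc1g cocg1.
by rewrite [LHS]addrC => /addrI.
Qed.

Definition cext_one : cext := ((- f 1%g 1%g)%R, 1).
Definition cext_mul (x y : cext) : cext :=
  ((x.1 + y.1 + f x.2 y.2)%R, x.2 * y.2).
Definition cext_inv (x : cext) : cext :=
  ((- x.1 - f x.2^-1%g x.2 - f 1%g 1%g)%R, x.2^-1).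

Lemma cext_mulA : associative cext_mul.
Proof.
move=> [a g] [b h] [c k]; congr pair => /=; last exact: mulgA.
rewrite -!addrA; congr (_ + (_ + _))%R.
by rewrite cocP addrCA [(f g h + _)%R]addrC.
Qed.

Lemma cext_mul1 : left_id cext_one cext_mul.
Proof.
by move=> [a g]; congr pair => /=; rewrite ?mul1g // coc1g addrAC addNr add0r.
Qed.

Lemma cext_mulr1 : right_id cext_one cext_mul.
Proof.
by move=> [a g]; congr pair => /=; rewrite ?mulg1 // cocg1 addrNK.
Qed.

Lemma cext_mulV : left_inverse cext_one cext_inv cext_mul.
Proof.
move=> [a g]; congr pair => /=; rewrite ?mulVg //.
by rewrite addrAC [(- a - _ - _)%R]addrAC addrNK addrAC addNr add0r.
Qed.

Lemma cext_mulrV : right_inverse cext_one cext_inv cext_mul.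
Proof.
move=> [a g]; congr pair => /=; rewrite ?mulgV // -cocgV.
by rewrite !addrA subrr sub0r addrAC addNr add0r.
Qed.

HB.instance Definition _ :=
  isGroup.Build cext cext_mulA cext_mul1 cext_mulr1 cext_mulV cext_mulrV.

Definition cext_in (a : A) : cext := ((a - f 1%g 1%g)%R, 1).
Definition cext_sec (g : G) : cext := (0%R, g).

Lemma cext_inM a b : cext_in (a + b)%R = cext_in a * cext_in b.
Proof.
congr pair => /=; last by rewrite mulg1.
by rewrite [RHS]addrAC addrNK addrA.
Qed.

Lemma cext_in0 : cext_in 0%R = 1.
Proof. by rewrite /cext_in sub0r. Qed.

Lemma cext_inC a x : cext_in a * x = x * cext_in a.
Proof.
case: x => b g; congr pair => /=; last by rewrite mulg1 mul1g.
by rewrite coc1g cocg1 [(b + _)%R]addrC.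
Qed.

Lemma cext_in_inj : injective cext_in.
Proof. by move=> a b [] /addIr. Qed.

Lemma cext_decomp x : x = cext_in x.1 * cext_sec x.2.
Proof.
by case: x => a g; congr pair => /=; rewrite ?mul1g // coc1g addr0 addrNK.
Qed.

Lemma cext_secM g h :
  cext_sec g * cext_sec h = cext_in (f g h) * cext_sec (g * h).
Proof.
congr pair => /=; last by rewrite mul1g.
by rewrite coc1g !addr0 add0r addrNK.
Qed.

Definition cext_comm (x y : cext) : cext := x * y * x^-1 * y^-1.

(** The two entries of a commutator only matter up to central elements. *)
Lemma cext_comm_sec x y :
  cext_comm x y = cext_comm (cext_sec x.2) (cext_sec y.2).
Proof.
rewrite [x in LHS]cext_decomp [y in LHS]cext_decomp.
move: (cext_in x.1) (cext_inC x.1) => a aC.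
move: (cext_in y.1) (cext_inC y.1) => b bC.
move: (cext_sec x.2) (cext_sec y.2) => u v; rewrite /cext_comm.
have commC (z x' y' : cext) : (forall t, z * t = t * z) ->
    z * x' * y' * (z * x')^-1 * y'^-1 = x' * y' * x'^-1 * y'^-1.
  by move=> zC; rewrite invgM -!(mulgA z) zC -!mulgA -(zC y'^-1) mulKg !mulgA.
rewrite commC //.
have -> : u * (b * v) = b * (u * v) by rewrite mulgA -bC mulgA.
by rewrite invgM !mulgA -!(mulgA b) bC mulgVK.
Qed.

Definition cext_wedge (g h : G) := cext_comm (cext_sec g) (cext_sec h).

Lemma cext_commE x y : cext_comm x y = cext_wedge x.2 y.2.
Proof. exact: cext_comm_sec. Qed.

Lemma cext_wedgeMl g g' h : cext_wedge (g * g') h =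
  cext_wedge (g * g' * g^-1) (g * h * g^-1) * cext_wedge g h.
Proof.
have := cext_commE (cext_sec g * cext_sec g') (cext_sec h) => /= <-.
have := cext_commE (cext_sec g * cext_sec g' * (cext_sec g)^-1)
  (cext_sec g * cext_sec h * (cext_sec g)^-1) => /= <-.
by rewrite /cext_wedge /cext_comm !gnorm.
Qed.

Lemma cext_wedgeMr g h h' : cext_wedge g (h * h') =
  cext_wedge g h * cext_wedge (h * g * h^-1) (h * h' * h^-1).
Proof.
have := cext_commE (cext_sec g) (cext_sec h * cext_sec h') => /= <-.
have := cext_commE (cext_sec h * cext_sec g * (cext_sec h)^-1)
  (cext_sec h * cext_sec h' * (cext_sec h)^-1) => /= <-.
by rewrite /cext_wedge /cext_comm !gnorm.
Qed.

Lemma cext_wedgegg g : cext_wedge g g = 1.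
Proof. by rewrite /cext_wedge /cext_comm !gnorm. Qed.

(** Commutators of lifts satisfy the relations of the exterior square: up to
    central elements, which do not matter, the canonical lift of a product is
    the product of the lifts. *)
Definition ext_to_cext : ext_square G -> cext := ext_lift cext_wedge.

Lemma ext_to_cextM : {morph ext_to_cext : x y / x * y}.
Proof.
exact: (ext_liftM cext_wedgeMl cext_wedgeMr cext_wedgegg).
Qed.

Definition cext_der (x : cext) : Prop := exists u, ext_to_cext u = x.

Lemma ext_to_cext1 : ext_to_cext 1 = 1.
Proof. exact: (ext_lift1 cext_wedgeMl cext_wedgeMr cext_wedgegg). Qed.

Lemma cext_der1 : cext_der 1.
Proof. by exists 1; apply: ext_to_cext1. Qed.

Lemma cext_derM x y : cext_der x -> cext_der y -> cext_der (x * y).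
Proof. by move=> [u <-] [v <-]; exists (u * v); apply: ext_to_cextM. Qed.

Lemma cext_derV x : cext_der x -> cext_der x^-1.
Proof.
move=> [u <-]; exists u^-1.
exact: (ext_liftV cext_wedgeMl cext_wedgeMr cext_wedgegg).
Qed.

Lemma cext_derR x y : cext_der (x * y * x^-1 * y^-1).
Proof.
exists (wedge x.2 y.2); rewrite /ext_to_cext.
by rewrite (ext_lift_wedge cext_wedgeMl cext_wedgeMr cext_wedgegg) -cext_commE.
Qed.

Definition cext_abz := Abelianizer cext_der1 cext_derM cext_derV cext_derR.

Definition cext_ab (a : A) : abz_quot cext_abz := abz_pi cext_abz (cext_in a).

Lemma cext_abD a b : cext_ab (a + b)%R = (cext_ab a + cext_ab b)%R.
Proof. by rewrite /cext_ab cext_inM abz_piM. Qed.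

Definition cext_ab_sec (g : G) : abz_quot cext_abz :=
  abz_pi cext_abz (cext_sec g).

(** In the abelianised extension the cocycle becomes the boundary of the bar
    2-cell (g, h), with the lifts of group elements as 1-cells. *)
Lemma cext_ab_coc g h :
  cext_ab (f g h) = (cext_ab_sec h - cext_ab_sec (g * h)%g + cext_ab_sec g)%R.
Proof.
have := congr1 (abz_pi cext_abz) (cext_secM g h); rewrite !abz_piM => E.
by rewrite addrAC [X in (X - _)%R]addrC [X in (X - _)%R]E addrK.
Qed.

(** Such an a is the image of an element of the exterior square. *)
Lemma cext_ab_eq0 a m : cext_ab a = 0%R ->
  (forall u : ext_square G, u ^+ m = 1) -> (a *+ m = 0)%R.
Proof.
move=> /abz_pi_eq0[u ua] Em; apply: cext_in_inj; rewrite cext_in0.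
have inX k : cext_in (a *+ k)%R = ext_to_cext (u ^+ k).
  elim: k => [|k IHk].
    by rewrite mulr0n cext_in0 expg0 ext_to_cext1.
  by rewrite mulrS cext_inM IHk expgS ext_to_cextM ua.
by rewrite inX Em ext_to_cext1.
Qed.

End CentralExtension.

(** * The bar complex and the Schur multiplier *)

Section SchurMultiplier.

Variable G : finGroupType.
Local Open Scope ring_scope.

Lemma chain_ind (T : finType) (P : chain T -> Prop) :
  (forall t, P (cell t)) -> P 0 -> (forall x, P x -> P (- x)) ->
  (forall x y, P x -> P y -> P (x + y)) -> forall z, P z.
Proof.
move=> Pc P0 PN PD z.
have -> : z = lin_ext (@cell T) z.
  apply/ffunP=> t; rewrite sum_ffunE (bigD1 t) //= big1 => [|u ut].
    by rewrite addr0 ffunMzE ffunE eqxx intz.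
  by rewrite ffunMzE ffunE eq_sym (negPf ut) mul0rz.
have PMn t n : P (cell t *+ n).
  by elim: n => [|n IHn]; rewrite ?mulr0n // mulrS; apply: PD.
apply: big_ind => // t _; case: (z t) => n; first exact: PMn.
by rewrite NegzE mulrNz; apply/PN/PMn.
Qed.

Definition bar_bd : {pred chain (G * G)%type} :=
  [pred z | `[< exists w, bar_d3 w = z >]].

Lemma bar_bd_zmod_closed : zmod_closed bar_bd.
Proof.
split=> [|x y]; rewrite !inE.
  by apply/asboolP; exists 0; rewrite raddf0.
move=> /asboolP[v vx] /asboolP[w wy]; apply/asboolP.
by exists (v - w); rewrite raddfB/= vx wy.
Qed.

HB.instance Definition _ :=
  GRing.isZmodClosed.Build _ bar_bd bar_bd_zmod_closed.

Definition chain_mod : zmodType := Quotient.quot bar_bd.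
Definition chain_pi (z : chain (G * G)%type) : chain_mod :=
  (\pi_chain_mod z)%qT.

Lemma chain_piD x y : chain_pi (x + y) = chain_pi x + chain_pi y.
Proof. exact: Quotient.pi_add. Qed.

Lemma chain_piN x : chain_pi (- x) = - chain_pi x.
Proof. exact: Quotient.pi_opp. Qed.

Lemma chain_pi0 : chain_pi 0 = 0.
Proof. by apply: (addIr (chain_pi 0)); rewrite -chain_piD !add0r. Qed.

Lemma chain_pi_eq0 z : chain_pi z = 0 <-> exists w, bar_d3 w = z.
Proof.
rewrite -chain_pi0; split=> [/eqP|zB].
  by rewrite -Quotient.idealrBE subr0 inE => /asboolP.
by apply/eqP; rewrite -Quotient.idealrBE subr0 inE; apply/asboolP.
Qed.

(** The universal 2-cocycle: the cocycle identity is the vanishing of the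
    boundaries of the 3-cells. *)
Definition taut (g h : G) : chain_mod := chain_pi (cell (g, h)).

Lemma tautP g h k : taut h k + taut g (h * k)%g = taut (g * h)%g k + taut g h.
Proof.
rewrite /taut -!chain_piD; apply: subr0_eq; rewrite -chain_piN -chain_piD.
apply/chain_pi_eq0; exists (cell (g, h, k)).
by rewrite /bar_d3 lin_ext_cell; apply/ffunP=> x; rewrite !ffunE; ring.
Qed.

Definition taut_coc := Cocycle tautP.

(** Both sides are additive in z, and agree on the cells. *)
Lemma cext_ab_bar_d2 z : cext_ab taut_coc (chain_pi z) =
  lin_ext (cext_ab_sec taut_coc) (bar_d2 z).
Proof.
have ab0 : cext_ab taut_coc 0 = 0.
  by apply: (addrI (cext_ab taut_coc 0)); rewrite -cext_abD !addr0.
elim/chain_ind: z => [[g h]||z IH|x y IHx IHy].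
- rewrite /bar_d2 lin_ext_cell !(raddfB, raddfD) /= !lin_ext_cell.
  exact: cext_ab_coc.
- by rewrite !raddf0 chain_pi0.
- rewrite !raddfN /= -IH; apply: (addIr (cext_ab taut_coc (chain_pi z))).
  by rewrite -cext_abD chain_piN !addNr.
- by rewrite !raddfD /= -IHx -IHy -cext_abD chain_piD.
Qed.

(** A cycle vanishes in the abelianised extension, so it comes from the exterior
    square. *)
Lemma H2_mulrn m (c : H2 G) :
  (forall u : ext_square G, (u ^+ m = 1)%g) -> c *+ m = 0.
Proof.
move=> Em; have -> : c = (\pi_(H2 G) (generic_quotient.repr c))%qT.
  by rewrite reprK.
move: (generic_quotient.repr c) => z; rewrite -raddfMn /=.
have dz : bar_d2 (val z) = 0 by have := valP z; rewrite inE => /eqP.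
have /cext_ab_eq0/(_ Em) : cext_ab taut_coc (chain_pi (val z)) = 0.
  by rewrite cext_ab_bar_d2 dz raddf0.
have -> : chain_pi (val z) *+ m = chain_pi (val z *+ m).
  by elim: m {Em} => [|m IHm]; rewrite ?chain_pi0 // !mulrS chain_piD IHm.
move=> /chain_pi_eq0[w dw].
apply/eqP; rewrite -(raddf0 (\pi_(H2 G))%qT) -Quotient.idealrBE subr0 inE.
by apply/asboolP; exists w; rewrite raddfMn.
Qed.

End SchurMultiplier.

Theorem corollary3p2 (p : nat) (gT : finGroupType) (c n : nat) :
  prime p -> odd p -> (p.-group [set: gT])%g ->
  nil_class [set: gT] = c -> n = up_log p c.+1 ->
  (group_exp (ext_square gT) %| p ^ n.-1 * exponent [set: gT])%N
  /\ (zmod_exp (H2 gT) %| p ^ n.-1 * exponent [set: gT])%N.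
Proof.
move=> p_pr _ pG Gc ->.
have [e Ge] : exists e, exponent [set: gT] = (p ^ e)%N.
  move: (exponent_dvdn [set: gT]); have [k ->] := p_natP pG.
  by move=> /(dvdn_pfactor _ _ p_pr)[e _ ->]; exists e.
have Gn : 'L_(p ^ up_log p c.+1)([set: gT]) = 1.
  have /(lcn_nil_classP c (pgroup_nil pG)) Lc : (nil_class [set: gT] <= c)%N.
    by rewrite Gc.
  apply/trivgP; rewrite -Lc lcn_sub_leq //.
  by apply: up_logP; apply: prime_gt1.
have GX (x : gT) : x ^+ (p ^ e) = 1 by rewrite -Ge expg_exponent // inE.
have EX (u : ext_square gT) := ext_square_expg p_pr GX Gn u.
rewrite Ge; split.
  by apply: group_exp_dvdn => //; rewrite muln_gt0 !expn_gt0 prime_gt0.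
apply: zmod_exp_dvdn => [|x]; first by rewrite muln_gt0 !expn_gt0 prime_gt0.
exact: H2_mulrn.
Qed.
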